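(* Let $L/k$ be a Galois extension of $\Gamma$-graded fields with Galois group $G$, and let $\mathbf r=(r_1,\dots,r_n)\in\Gamma^n$. Then for every $\alpha\in\mathrm Z^1(G,\mathrm{GL}(L,\mathbf r))$ there exist $\mathbf s=(s_1,\dots,s_n)\in\Gamma^n$ and $P\in\mathrm{GL}(L,\mathbf r,\mathbf s)$ such that $$\alpha(\sigma)=(\sigma\cdot P)\,P^{-1}\quad\text{for all }\sigma\in G .$$
   Context: $\Gamma$ is a divisible, torsion-free, ordered abelian group, written multiplicatively. A $\Gamma$-graded field is a commutative $\Gamma$-graded ring $k=\bigoplus_{\gamma\in\Gamma}k_\gamma$, non-zero, in which every non-zero homogeneous element is invertible; morphisms preserve degrees. An extension $L/k$ of graded fields is Galois if every homogeneous element of $L$ is algebraic over $k$ and the graded field of invariants of the group $G=\mathrm{Gal}(L/k)$ of graded $k$-automorphisms of $L$ is $k$. For $\mathbf r,\mathbf s\in\Gamma^n$, $\mathrm M(L,\mathbf s,\mathbf r)=\{(a_{ij})_{1\le i,j\le n}: a_{ij}\in L_{s_ir_j^{-1}}\}$ (matrices of degree-$1$ homogeneous linear maps). Products of elements of $\mathrm M(L,\mathbf s,\mathbf r)$ and $\mathrm M(L,\mathbf r,\mathbf s')$ lie in $\mathrm M(L,\mathbf s,\mathbf s')$, and the determinant of an element of $\mathrm M(L,\mathbf s,\mathbf r)$ is homogeneous of degree $\prod_is_ir_i^{-1}$. $\mathrm{GL}(L,\mathbf s,\mathbf r)\subset\mathrm M(L,\mathbf s,\mathbf r)$ is the subset of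 matrices with non-zero determinant; such a matrix has an inverse in $\mathrm{GL}(L,\mathbf r,\mathbf s)$. $\mathrm{GL}(L,\mathbf r)=\mathrm{GL}(L,\mathbf r,\mathbf r)$ is a group. $G$ acts on matrices entrywise. $\mathrm Z^1(G,\mathrm{GL}(L,\mathbf r))$ is the set of $1$-cocycles, i.e. maps $\alpha:G\to\mathrm{GL}(L,\mathbf r)$ with $\alpha(\sigma\tau)=(\sigma\cdot\alpha(\tau))\,\alpha(\sigma)$ for all $\sigma,\tau\in G$; as usual for profinite groups, if $L/k$ is infinite they are required to be continuous (Krull topology on $G$, discrete topology on the target). *)

(* Defs.v *)
From HB Require Import structures.
From mathcomp Require Import all_boot all_order all_algebra.
From mathcomp Require Import all_classical topology.

Set Implicit Arguments.
Unset Strict Implicit.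
Unset Printing Implicit Defensive.

Import Order.TTheory GRing.Theory Num.Theory.

Local Open Scope classical_set_scope.
Local Open Scope ring_scope.

(** The group of degrees is written additively, so that the degree
    [s_i r_j^-1] reads [s i - r j].  The structure [porderZmodType] itself does
    not relate the order to the addition; [ler_translate] does. *)
Record divisible_ordered_group (Gamma : porderZmodType) : Prop := {
  ler_is_total : total (<=%R : rel Gamma);
  ler_translate : forall x y z : Gamma, x <= y -> z + x <= z + y;
  torsion_free : forall (m : nat) (x : Gamma),
    (0 < m)%N -> x *+ m = 0 -> x = 0;
  divisible : forall (m : nat) (x : Gamma),
    (0 < m)%N -> exists y : Gamma, y *+ m = x
}.

Section GradedRings.
Variable Gamma : zmodType.

(** [x] is a finite sum of homogeneous elements, of distinct degrees, all lying
    in [F]. *)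
Definition homogeneous_sum (A : nzRingType) (gr : Gamma -> set A) (F : set A)
    (x : A) : Prop :=
  exists (s : seq Gamma) (f : Gamma -> A),
    [/\ uniq s, forall g, gr g (f g) /\ F (f g) & x = \sum_(g <- s) f g].

Record is_grading (A : nzRingType) (gr : Gamma -> set A) : Prop := {
  grading0 : forall g, gr g 0;
  gradingB : forall g x y, gr g x -> gr g y -> gr g (x - y);
  grading1 : gr 0 1;
  gradingM : forall g h x y, gr g x -> gr h y -> gr (g + h) (x * y);
  grading_sum : forall x, homogeneous_sum gr setT x;
  grading_direct : forall (s : seq Gamma) (f : Gamma -> A),
    uniq s -> (forall g, gr g (f g)) -> \sum_(g <- s) f g = 0 ->
    forall g, g \in s -> f g = 0
}.

(** The type [comUnitRingType] carries [1 != 0], and an inverse that is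
    meaningful on the units only. *)
Record is_graded_field (A : comUnitRingType) (gr : Gamma -> set A) : Prop := {
  graded_field_grading : is_grading gr;
  graded_field_unit : forall g x, gr g x -> x != 0 -> x \is a GRing.unit
}.

Section Extension.
Variables (k L : comUnitRingType) (iota : {rmorphism k -> L}).
Variables (kg : Gamma -> set k) (Lg : Gamma -> set L).

Record graded_extension : Prop := {
  ext_base : is_graded_field kg;
  ext_top : is_graded_field Lg;
  ext_degree : forall g a, kg g a -> Lg g (iota a)
}.

Definition algebraic_over (x : L) : Prop :=
  exists2 p : {poly k}, p != 0 & root (map_poly iota p) x.

Record graded_subextension (F : set L) : Prop := {
  subext_base : forall a, F (iota a);
  subextB : forall x y, F x -> F y -> F (x - y);
  subextM : forall x y, F x -> F y -> F (x * y);
  subext_graded : forall x, F x -> homogeneous_sum Lg F x;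
  subextV : forall g x, Lg g x -> F x -> x != 0 -> F x^-1
}.

Definition finite_over (F : set L) : Prop :=
  exists (m : nat) (b : 'I_m -> L),
    (forall i, F (b i)) /\
    forall x, F x -> exists c : 'I_m -> k, x = \sum_i iota (c i) * b i.

(** The degree condition is an equivalence because the inverse automorphism
    preserves degrees too. *)
Record is_graded_automorphism (f : L -> L) : Prop := {
  graded_aut_zmod : zmod_morphism f;
  graded_aut_monoid : monoid_morphism f;
  graded_aut_bij : bijective f;
  graded_aut_degree : forall g x, Lg g (f x) <-> Lg g x;
  graded_aut_base : forall a, f (iota a) = iota a
}.

Record galois_group := GaloisAut {
  galois_fun :> L -> L;
  galois_autP : is_graded_automorphism galois_fun
}.

HB.instance Definition _ := gen_eqMixin galois_group.
HB.instance Definition _ := gen_choiceMixin galois_group.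

HB.instance Definition _ (u : galois_group) :=
  GRing.isZmodMorphism.Build L L u (graded_aut_zmod (galois_autP u)).
HB.instance Definition _ (u : galois_group) :=
  GRing.isMonoidMorphism.Build L L u (graded_aut_monoid (galois_autP u)).

Lemma galois_ext (u v : galois_group) : (forall x, u x = v x) -> u = v.
Proof.
case: u v => [u uP] [v vP] /= /funext uv.
by case: _ / uv vP => vP; congr GaloisAut; exact: Prop_irrelevance.
Qed.

Lemma galois_one_subproof : is_graded_automorphism idfun.
Proof. by split=> //; exists id. Qed.

Definition galois_one := GaloisAut galois_one_subproof.

Lemma galois_mul_subproof (u v : galois_group) :
  is_graded_automorphism (fun x => u (v x)).
Proof.
split.
- by move=> x y /=; rewrite !rmorphB.
- by split=> [|x y /=]; rewrite /= ?rmorph1 ?rmorphM.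
- exact: bij_comp (graded_aut_bij (galois_autP u))
                  (graded_aut_bij (galois_autP v)).
- move=> g x; apply: iff_trans (graded_aut_degree (galois_autP v) g x).
  exact: (graded_aut_degree (galois_autP u)).
- by move=> a /=; rewrite !(graded_aut_base (galois_autP _)).
Qed.

Definition galois_mul (u v : galois_group) :=
  GaloisAut (galois_mul_subproof u v).

Lemma galois_inv_subproof (u : galois_group) :
  exists v : galois_group, cancel u v /\ cancel v u.
Proof.
have [v uK vK] := graded_aut_bij (galois_autP u).
suff vP : is_graded_automorphism v by exists (GaloisAut vP).
split.
- by move=> x y; apply: (can_inj uK); rewrite rmorphB /= !vK.
- split=> [|x y]; apply: (can_inj uK); last by rewrite rmorphM /= !vK.
  by rewrite vK rmorph1.
- by exists u.
- move=> g x; apply: iff_sym.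
  by have := graded_aut_degree (galois_autP u) g (v x); rewrite vK.
- by move=> a; apply: (can_inj uK); rewrite vK (graded_aut_base (galois_autP u)).
Qed.

Definition galois_inv (u : galois_group) := sval (cid (galois_inv_subproof u)).

Lemma galois_mulA : associative galois_mul.
Proof. by move=> u v w; apply: galois_ext. Qed.

Lemma galois_mul1 : left_id galois_one galois_mul.
Proof. by move=> u; apply: galois_ext. Qed.

Lemma galois_mulr1 : right_id galois_one galois_mul.
Proof. by move=> u; apply: galois_ext. Qed.

Lemma galois_mulV : left_inverse galois_one galois_inv galois_mul.
Proof.
move=> u; apply: galois_ext => x /=; rewrite /galois_inv.
by case: (cid _) => v [/= uK vK]; rewrite uK.
Qed.

Lemma galois_mulrV : right_inverse galois_one galois_inv galois_mul.
Proof.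
move=> u; apply: galois_ext => x /=; rewrite /galois_inv.
by case: (cid _) => v [/= uK vK]; rewrite vK.
Qed.

HB.instance Definition _ := isGroup.Build galois_group
  galois_mulA galois_mul1 galois_mulr1 galois_mulV galois_mulrV.

HB.instance Definition _ := isPointed.Build galois_group galois_one.

(** Krull topology: it is generated by the cosets [u * Gal(L / F)] for [F]
    ranging over the finite graded subextensions of [L / k]. *)
HB.instance Definition _ := @isSubBaseTopological.Build galois_group
  (galois_group * set L)%type
  [set uF | graded_subextension uF.2 /\ finite_over uF.2]
  (fun uF => [set v | forall x, uF.2 x -> v x = uF.1 x]).

Record is_galois : Prop := {
  galois_algebraic : forall g x, Lg g x -> algebraic_over x;
  galois_invariants :
    [set x | forall u : galois_group, u x = x] = range iota
}.

Definition graded_mx (n : nat) (s r : 'I_n -> Gamma) : set 'M[L]_n :=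
  [set A | forall i j, Lg (s i - r j) (A i j)].

Definition graded_GL (n : nat) (s r : 'I_n -> Gamma) : set 'M[L]_n :=
  [set A | graded_mx s r A /\ \det A != 0].

Record is_cocycle (n : nat) (r : 'I_n -> Gamma) (alpha : galois_group -> 'M[L]_n)
    : Prop := {
  cocycle_GL : forall u, graded_GL r r (alpha u);
  cocycle_mul : forall u v : galois_group,
    alpha (u * v)%g = map_mx u (alpha v) *m alpha u;
  cocycle_continuous : ~ finite_over setT ->
    continuous (alpha : galois_group -> discrete_topology 'M[L]_n)
}.

End Extension.
End GradedRings.

(* Main.v *)
Require Import Defs.
From mathcomp Require Import all_boot all_order all_algebra.
From mathcomp Require Import perm finmap.
From mathcomp Require Import all_classical topology.

Set Implicit Arguments.
Unset Strict Implicit.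
Unset Printing Implicit Defensive.

Import GRing.Theory.
Local Open Scope ring_scope.

(** This is Hilbert's theorem 90 in the form of Galois descent.  The cocycle
    twists the semilinear action of the Galois group on columns into
    [u . v = (alpha u)^-1 u(v)], whose invariants are the columns [v] with
    [alpha u *m v = map_mx u v].  A matrix [P] is as required exactly when its
    columns are invariant and homogeneous and its determinant is non-zero, so
    there must be enough homogeneous invariant columns.

    Invariant columns are traces of [x e_j] for the twisted action.  The group
    may be infinite, but some finite set [X] of homogeneous elements controls
    the cocycle: [alpha u] is determined by the values of [u] on [X]
    ([cocycle_support]; this is continuity when [L] is infinite over [k]).
    Since the elements of [X] are algebraic, only finitely many tuples of
    values occur ([joint_conjugates]), and the trace is a sum over those tuples,
    for [x] homogeneous and such that [u(x)] depends only on the values of [u]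
    on [X].

    If a row [l] kills all traces of all [x e_j], then Dedekind's independence
    of characters gives [l = 0] ([dedekind_independence], [invariant_vector]).
    Thus the columns of the identity matrix can be replaced one after the other
    by invariant ones: with [l] a row of the adjugate, [l *m v] is the
    determinant after [v] has replaced the corresponding column.

    In a graded field only homogeneous elements are sure to be invertible,
    and nothing else gets inverted: differences of conjugates of a homogeneous
    element, which serve both to count conjugates and to separate characters,
    and determinants of graded matrices. *)

(** * Independence of characters *)

Section Dedekind.
Variables (A : pzRingType) (R : comUnitRingType) (I : eqType).
Variables (M : set A) (chi : I -> A -> R).
Hypotheses (M1 : M 1) (MM : forall x y, M x -> M y -> M (x * y)).
Hypothesis chi1 : forall i, chi i 1 = 1.
Hypothesis chiM : forall i x y, M x -> M y -> chi i (x * y) = chi i x * chi i y.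

(** The usual shortening of a relation: evaluating at [x * y] and subtracting
    [chi j x] times the evaluation at [y] removes the term of index [j].  As [R]
    is a mere ring, distinct characters must differ by a unit somewhere. *)
Lemma dedekind_independence (T : seq I) (d : I -> R) :
  uniq T ->
  (forall i j, i \in T -> j \in T -> i != j ->
    exists2 x, M x & chi i x - chi j x \is a GRing.unit) ->
  (forall x, M x -> \sum_(i <- T) d i * chi i x = 0) ->
  forall i, i \in T -> d i = 0.
Proof.
elim: T d => [|j T IH] d //= /andP[jT uT] sep dep.
have dT i : i \in T -> d i = 0.
  move=> iT.
  have iT1 : i \in j :: T by rewrite inE iT orbT.
  have [x Mx ux] := sep i j iT1 (mem_head j T) (memPn jT i iT).
  apply: (mulIr ux); rewrite mul0r.
  apply: (IH (fun i => d i * (chi i x - chi j x))) iT => // [a b aT bT|y My].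
    by apply: sep; rewrite inE ?aT ?bT orbT.
  have := dep (x * y) (MM Mx My); have := dep y My.
  rewrite !big_cons => /eqP + /eqP; rewrite !(addrC (d j * _)) !addr_eq0.
  move=> /eqP e1 /eqP e2.
  transitivity (\sum_(a <- T) (d a * chi a (x * y) - chi j x * (d a * chi a y))).
    by apply: eq_bigr => a _; rewrite chiM // mulrBr mulrBl !mulrA (mulrC (chi j x)).
  by rewrite sumrB -mulr_sumr e1 e2 chiM // mulrN opprK mulrCA addNr.
move=> i; rewrite inE => /predU1P[->|/dT//].
have := dep 1 M1; rewrite big_cons chi1 mulr1 big_seq big1 ?addr0 //.
by move=> a aT; rewrite dT // mul0r.
Qed.
End Dedekind.

(** * Graded rings and graded matrices *)

Section Grading.
Variables (Gamma : zmodType) (A : nzRingType) (gr : Gamma -> set A).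
Hypothesis grP : is_grading gr.

Lemma gradingN g x : gr g x -> gr g (- x).
Proof.
by move=> gx; rewrite -sub0r; apply: gradingB grP _ _ _ _ gx; apply: grading0.
Qed.

Lemma gradingD g x y : gr g x -> gr g y -> gr g (x + y).
Proof.
move=> gx gy; rewrite -[y]opprK.
exact: gradingB grP _ _ _ gx (gradingN gy).
Qed.

Lemma grading_bigsum g (I : Type) (s : seq I) (P : pred I) (F : I -> A) :
  (forall i, P i -> gr g (F i)) -> gr g (\sum_(i <- s | P i) F i).
Proof.
by move=> FP; elim/big_ind: _ => //; [apply: grading0 | move=> x y; apply: gradingD].
Qed.

Lemma grading_bigprod (I : Type) (s : seq I) (d : I -> Gamma) (F : I -> A) :
  (forall i, gr (d i) (F i)) -> gr (\sum_(i <- s) d i) (\prod_(i <- s) F i).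
Proof.
move=> FP; elim/big_rec2: _ => [|i x y _]; first exact: grading1.
by move=> ?; apply: gradingM.
Qed.

End Grading.

Section GradedDet.
Variables (Gamma : zmodType) (L : comUnitRingType) (Lg : Gamma -> set L).
Hypothesis LP : is_graded_field Lg.
Let grP := graded_field_grading LP.

Lemma graded_det n (s r : 'I_n -> Gamma) (P : 'M[L]_n) :
  graded_mx Lg s r P -> Lg (\sum_i s i - \sum_i r i) (\det P).
Proof.
move=> gP; apply: (grading_bigsum grP) => p _.
rewrite [X in _ - X](reindex_inj (@perm_inj _ p)) /= -sumrB.
have := grading_bigprod grP (index_enum 'I_n) (fun i => gP i (p i)).
by rewrite mulr_sign; case: ifP => // _; apply: gradingN.
Qed.

(** The determinant is homogeneous, so it is invertible once it is non-zero. *)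
Lemma graded_GL_unit n (s r : 'I_n -> Gamma) (P : 'M[L]_n) :
  graded_GL Lg s r P -> P \in unitmx.
Proof. by case=> /graded_det dP /(graded_field_unit LP dP). Qed.
End GradedDet.

(** * Replacing a column *)

Definition set_col (R : Type) (m n : nat) (j0 : 'I_n) (v : 'cV[R]_m)
    (P : 'M[R]_(m, n)) :=
  \matrix_(i, j) (if j == j0 then v i 0 else P i j).

(** Expansion along the new column, whose cofactors are those of [P]. *)
Lemma det_set_col (R : comNzRingType) n (j0 : 'I_n) (v : 'cV[R]_n) (P : 'M[R]_n) :
  \det (set_col j0 v P) = (row j0 (\adj P) *m v) 0 0.
Proof.
rewrite (expand_det_col _ j0) mxE; apply: eq_bigr => i _.
rewrite !mxE eqxx mulrC /cofactor; congr (_ * \det _ * _).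
by apply/matrixP => a b; rewrite !mxE eq_sym (negPf (neq_lift _ _)).
Qed.

(** * Graded automorphisms and conjugates *)

Section Extension.
Variables (Gamma : zmodType) (k L : comUnitRingType) (iota : {rmorphism k -> L}).
Variables (kg : Gamma -> set k) (Lg : Gamma -> set L).
Hypothesis ext : graded_extension iota kg Lg.
Local Notation G := (galois_group iota Lg).
Let LP : is_graded_field Lg := ext_top ext.
Let grP := graded_field_grading LP.

Definition homogeneous (x : L) := exists g, Lg g x.

Lemma galois_degree (u : G) g x : Lg g x -> Lg g (u x).
Proof. by move=> gx; apply/(graded_aut_degree (galois_autP u)). Qed.

Lemma galois_mulE (u v : G) x : (u * v)%g x = u (v x).
Proof. by []. Qed.

Lemma galoisK (u : G) : cancel u (u^-1)%g.
Proof. by move=> x; rewrite -galois_mulE mulVg. Qed.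

Lemma galoisVK (u : G) : cancel (u^-1)%g u.
Proof. by move=> x; rewrite -galois_mulE mulgV. Qed.

(** A degree-preserving morphism is injective as soon as it is so on homogeneous
    elements, where it maps units to units. *)
Lemma extension_inj : injective iota.
Proof.
apply: raddf_inj => a ia0.
have kP := ext_base ext.
have [s [f [us fP ea]]] := grading_sum (graded_field_grading kP) a.
rewrite ea big_seq big1 // => g gs; apply/eqP/negP => /negP fg0.
have /(rmorph_unit iota) := graded_field_unit kP (fP g).1 fg0.
suff -> : iota (f g) = 0 by rewrite unitr0.
apply: (grading_direct grP us (f := fun g => iota (f g))) gs => [h|].
  by apply: (ext_degree ext); case: (fP h).
by rewrite -rmorph_sum -ea.
Qed.

Lemma conjugate_diff_unit (u v : G) x :
  homogeneous x -> u x != v x -> u x - v x \is a GRing.unit.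
Proof.
move=> [g gx]; rewrite -subr_eq0; apply: (graded_field_unit LP (g := g)).
by apply: (gradingB grP); apply: galois_degree.
Qed.

(** A non-zero polynomial over a ring may have infinitely many roots, but not if
    the differences of distinct roots are units. *)
Lemma conjugates_finite x :
  homogeneous x -> algebraic_over iota x -> finite_set (range (fun u : G => u x)).
Proof.
move=> hx [p p0 px]; apply: contrapT.
move=> /(infinite_set_fset (size (map_poly iota p))).
case=> B sB; rewrite leqNgt => /negP; apply.
have q0 : map_poly iota p != 0.
  rewrite -(rmorph0 (map_poly iota)); apply: contra_neq p0.
  by apply: map_inj_poly; [apply: extension_inj | rewrite rmorph0].
apply: max_ring_poly_roots q0 _ _.
  apply/allP => _ /sB [u _ <-]; move/eqP: px => px; apply/eqP.
  rewrite -[RHS](rmorph0 u) -px -horner_map -map_poly_comp; congr _.[_].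
  by apply: eq_map_poly => a /=; rewrite (graded_aut_base (galois_autP u)).
have : {subset enum_fset B <= [pred y | `[< exists u : G, u x = y >]]}.
  by move=> y /sB [u _ uy]; apply/asboolP; exists u.
elim: (enum_fset B) (fset_uniq B) => //= y s IH /andP[ys us] sP.
have -> : uniq_roots s.
  by apply: IH => // z zs; apply: sP; rewrite inE zs orbT.
rewrite andbT.
have /asboolP[u uy] := sP y (mem_head _ _).
apply/allP => z zs; rewrite /diff_roots mulrC eqxx /=.
have /asboolP[v vz] : `[< exists u : G, u x = z >] by apply: sP; rewrite inE zs orbT.
by rewrite -uy -vz conjugate_diff_unit // uy vz (memPn ys).
Qed.

Lemma joint_conjugates (X : seq L) :
  (forall x, x \in X -> homogeneous x) ->
  (forall g x, Lg g x -> algebraic_over iota x) ->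
  exists2 T : seq (seq L), uniq T &
    forall c, c \in T <-> exists u : G, map u X = c.
Proof.
move=> hX alg.
suff /finite_seqP[T TE] : finite_set (range (fun u : G => map u X)).
  exists (undup T); first exact: undup_uniq.
  move=> c; rewrite mem_undup; have -> : (c \in T : Prop) = [set` T]%classic c by [].
  by rewrite -TE; split=> [[u _ <-]|[u <-]]; exists u.
elim: X hX => [|x X IH] hX.
  by apply: sub_finite_set (finite_set1 [::]) => _ [u _ <-].
have hx := hX x (mem_head _ _); have [g gx] := hx.
apply: sub_finite_set
  (finite_image2 cons (conjugates_finite hx (alg g x gx)) (IH _)).
  by move=> _ [u _ <-]; exists (u x); [exists u | exists (map u X); [exists u|]].
by move=> y yX; apply: hX; rewrite inE yX orbT.
Qed.

(** An automorphism over [k] is determined on [F] by the images of generators,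
    hence by those of their homogeneous components. *)
Lemma finite_over_determined (F : set L) : finite_over iota F ->
  exists2 X : seq L, (forall x, x \in X -> homogeneous x) &
    forall u : G, {in X, forall x, u x = x} -> forall x, F x -> u x = x.
Proof.
move=> [m [b [_ bF]]].
have /choice[Y YP] (i : 'I_m) : exists Y : seq L,
    (forall x, x \in Y -> homogeneous x) /\ b i = \sum_(y <- Y) y.
  have [s [f [_ fP ->]]] := grading_sum grP (b i).
  exists (map f s); split; last by rewrite big_map.
  by move=> _ /mapP[g _ ->]; exists g; case: (fP g).
exists (flatten [seq Y i | i <- enum 'I_m]).
  by move=> x /flatten_mapP[i _]; apply: (YP i).1.
move=> u uX x /bF [c ->]; rewrite rmorph_sum; apply: eq_bigr => i _.
rewrite rmorphM /= (graded_aut_base (galois_autP u)) (YP i).2 rmorph_sum.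
congr (_ * _).
rewrite big_seq [RHS]big_seq; apply: eq_bigr => y yY; apply: uX.
by apply/flatten_mapP; exists i; rewrite ?mem_enum.
Qed.

(** * Cocycles and twisted traces *)

Section Cocycle.
Variables (n : nat) (r : 'I_n -> Gamma) (alpha : G -> 'M[L]_n).
Hypothesis aP : is_cocycle r alpha.
Hypothesis alg : forall g x, Lg g x -> algebraic_over iota x.

Lemma cocycle_unit u : alpha u \in unitmx.
Proof. exact: (graded_GL_unit LP (cocycle_GL aP u)). Qed.

Lemma cocycle1 : alpha 1%g = 1%:M.
Proof.
have := cocycle_mul aP 1%g 1%g; rewrite mulg1.
have -> : map_mx (1%g : G) (alpha 1%g) = alpha 1%g.
  by apply/matrixP => i j; rewrite mxE.
move/(congr1 (mulmx (invmx (alpha 1%g)))).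
by rewrite mulKmx ?cocycle_unit // mulVmx ?cocycle_unit.
Qed.

(** If [L] is finite over [k], an automorphism that fixes generators is trivial.
    Otherwise continuity provides a basic neighbourhood of [1] on which [alpha]
    is constant; it involves finitely many finite subextensions, and fixing
    generators of all of them suffices to be in it. *)
Lemma cocycle_support :
  exists2 X : seq L, (forall x, x \in X -> homogeneous x) &
    forall u : G, {in X, forall x, u x = x} -> alpha u = 1%:M.
Proof.
have [finL|infL] := pselect (finite_over iota [set: L]%classic).
  have [X hX XP] := finite_over_determined finL; exists X => // u uX.
  suff -> : u = 1%g by rewrite cocycle1.
  by apply: galois_ext => x; apply: XP.
have /(_ 1%g [set alpha 1%g]%classic) := cocycle_continuous aP infL.
case; first exact: discrete_set1.
move=> O [[D sD <-] [/= B DB B1]] sO.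
have [D' D'P BE] := sD B DB.
have /choice[Y YP] (uF : G * set L) : exists Y : seq L,
    (forall x, x \in Y -> homogeneous x) /\ (uF \in D' ->
    forall u : G, {in Y, forall x, u x = x} -> forall x, uF.2 x -> u x = x).
  have [uFD|_] := boolP (uF \in D'); last by exists [::].
  have /set_mem[_ /finite_over_determined[Y hY YP]] := D'P _ uFD.
  by exists Y.
exists (flatten [seq Y uF | uF <- enum_fset D']).
  by move=> x /flatten_mapP[uF _]; apply: (YP uF).1.
move=> u uX; rewrite -cocycle1; apply: sO; exists B => //.
rewrite -BE => uF uFD x Fx.
rewrite ((YP uF).2 uFD u _ x Fx); last first.
  by move=> y yY; apply: uX; apply/flatten_mapP; exists uF.
by move: B1; rewrite -BE => /(_ uF uFD x Fx).
Qed.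

(** The inverse of [alpha u]; this formula shows that it is graded. *)
Definition cocycle_inv (u : G) := map_mx u (alpha u^-1%g).

Lemma cocycle_invK u : cocycle_inv u *m alpha u = 1%:M.
Proof. by rewrite /cocycle_inv -(cocycle_mul aP) mulgV cocycle1. Qed.

Lemma cocycle_inv_mul (u v : G) :
  alpha u *m cocycle_inv (u * v)%g = map_mx u (cocycle_inv v).
Proof.
have h : map_mx u (cocycle_inv v) *m alpha (u * v)%g = alpha u.
  by rewrite (cocycle_mul aP) mulmxA -map_mxM cocycle_invK map_mx1 mul1mx.
by rewrite -{1}h -mulmxA (mulmx1C (cocycle_invK _)) mulmx1.
Qed.

Section TwistedTrace.
Variable X : seq L.
Hypothesis hX : forall x, x \in X -> homogeneous x.
Hypothesis XP : forall u : G, {in X, forall x, u x = x} -> alpha u = 1%:M.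

Lemma cocycle_ext (u v : G) : map u X = map v X -> alpha u = alpha v.
Proof.
move=> /eq_in_map uv; rewrite -[u](mulVKg v) (cocycle_mul aP) XP ?map_mx1 ?mul1mx //.
by move=> x xX; rewrite galois_mulE (uv _ xX) galoisK.
Qed.

Lemma cocycle_inv_ext (u v : G) :
  map u X = map v X -> cocycle_inv u = cocycle_inv v.
Proof.
move=> uv; rewrite -[LHS]mulmx1 -(mulmx1C (cocycle_invK v)) -(cocycle_ext uv).
by rewrite mulmxA cocycle_invK mul1mx.
Qed.

(** Homogeneity keeps the traces below homogeneous, and dependence on the values
    on [X] alone makes them independent of the chosen representatives. *)
Definition determined : set L := [set x | homogeneous x /\
  forall u v : G, map u X = map v X -> u x = v x]%classic.

Lemma determined_base x : x \in X -> determined x.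
Proof. by move=> xX; split=> [|u v /eq_in_map uv]; [apply: hX | apply: uv]. Qed.

Lemma determined1 : determined 1.
Proof.
by split=> [|u v _]; [exists 0; apply: grading1 grP | rewrite !rmorph1].
Qed.

Lemma determinedM x y : determined x -> determined y -> determined (x * y).
Proof.
move=> [[g gx] Mx] [[h hy] My]; split=> [|u v uv].
  by exists (g + h); apply: gradingM grP _ _ _ _ gx hy.
by rewrite !rmorphM /= (Mx _ _ uv) (My _ _ uv).
Qed.

(** The tuples in [T] stand for the cosets of the pointwise stabiliser of [X],
    and [rep] chooses an automorphism in each. *)
Variables (T : seq (seq L)) (rep : seq L -> G).
Hypotheses (uT : uniq T) (TP : forall c, c \in T <-> exists u : G, map u X = c).
Hypothesis repP : forall c, c \in T -> map (rep c) X = c.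

Definition twisted_trace (x : L) (j : 'I_n) : 'cV[L]_n :=
  \sum_(c <- T) rep c x *: col j (cocycle_inv (rep c)).

Lemma twisted_trace_graded g x j : Lg g x ->
  forall i, Lg (r i - (r j - g)) (twisted_trace x j i 0).
Proof.
move=> gx i; rewrite summxE; apply: (grading_bigsum grP) => c _.
rewrite opprB addrCA 3!mxE; apply: (gradingM grP); first exact: galois_degree.
by apply: galois_degree; apply: (cocycle_GL aP _).1.
Qed.

(** Composition with [u] on the left permutes the tuples: it acts on [T] as
    [map u].  It may change representatives, but not the summands. *)
Lemma twisted_trace_invariant x j (u : G) : determined x ->
  alpha u *m twisted_trace x j = map_mx u (twisted_trace x j).
Proof.
move=> [_ Mx].
pose f w : 'cV[L]_n := galois_fun w x *: col j (cocycle_inv w).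
have f_ext (w w' : G) : map w X = map w' X -> f w = f w'.
  by move=> ww; rewrite /f (Mx _ _ ww) (cocycle_inv_ext ww).
have fu w : map_mx u (f w) = alpha u *m f (u * w)%g.
  by rewrite map_mxZ map_col -cocycle_inv_mul /f -scalemxAr !colE mulmxA.
have uinj : injective (map u) by apply: inj_map; apply: can_inj (galoisK u).
have perm : perm_eq T (map (map u) T).
  apply: uniq_perm => //; first by rewrite map_inj_uniq.
  move=> c; apply/idP/mapP => [/TP[v vc]|[c' /TP[v <-] ->]].
    exists (map (u^-1 * v)%g X); first by apply/TP; exists (u^-1 * v)%g.
    by rewrite -map_comp -vc; apply: eq_map => y; rewrite /= [RHS](galoisVK u (v y)).
  by apply/TP; exists (u * v)%g; rewrite -map_comp.
rewrite /twisted_trace [in LHS](perm_big _ perm) big_map mulmx_sumr.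
rewrite [RHS]raddf_sum big_seq [RHS]big_seq.
apply: eq_bigr => c cT; rewrite -[RHS]/(map_mx u (f (rep c))) fu.
congr (_ *m _); apply: (f_ext (rep (map u c)) (u * rep c)%g).
rewrite repP; first by rewrite -{1}(repP cT) -map_comp.
by apply/TP; exists (u * rep c)%g; rewrite -{2}(repP cT) -map_comp.
Qed.

(** The pairing of [l] with the traces of [x e_j] is a linear combination of the
    values at [x] of the characters [rep c], with coefficients the entries of
    [l *m cocycle_inv (rep c)]; by independence all of these vanish. *)
Lemma twisted_trace_separates (l : 'rV[L]_n) :
  (forall x j, determined x -> (l *m twisted_trace x j) 0 0 = 0) -> l = 0.
Proof.
move=> ltr; pose c1 := map (1%g : G) X.
have cT : c1 \in T by apply/TP; exists 1%g.
rewrite -[l]mulmx1 -(cocycle_invK (rep c1)) mulmxA.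
suff -> : l *m cocycle_inv (rep c1) = 0 by rewrite mul0mx.
apply/rowP => j; rewrite [RHS]mxE.
apply: (@dedekind_independence L L _ determined (fun c => rep c) determined1
  determinedM _ _ T (fun c => (l *m cocycle_inv (rep c)) 0 j)) cT => //.
- by move=> c; rewrite rmorph1.
- by move=> c x y _ _; rewrite rmorphM.
- move=> c c' cT c'T cc'.
  have [x xX xne] : exists2 x, x \in X & rep c x != rep c' x.
    apply: contrapT => none; case/eqP: cc'.
    rewrite -(repP cT) -(repP c'T); apply/eq_in_map => x xX.
    by apply: contrapT => /eqP h; apply: none; exists x.
  exists x; first exact: determined_base.
  by apply: conjugate_diff_unit xne; apply: hX.
- move=> x Mx; rewrite -[RHS](ltr x j Mx) mulmx_sumr summxE.
  apply: eq_bigr => c _.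
  by rewrite -scalemxAr [RHS]mxE mulrC colE mulmxA -colE [in RHS]mxE.
Qed.

End TwistedTrace.

Lemma invariant_vector (l : 'rV[L]_n) : l != 0 ->
  exists (s : Gamma) (v : 'cV[L]_n),
    [/\ forall i, Lg (r i - s) (v i 0),
        forall u, alpha u *m v = map_mx u v & (l *m v) 0 0 != 0].
Proof.
move=> l0; have [X hX XP] := cocycle_support.
have [T uT TP] := joint_conjugates hX alg.
have /choice[rep repP] c : exists u : G, c \in T -> map u X = c.
  have [/TP[u uc]|_] := boolP (c \in T); last by exists 1%g.
  by exists u.
have [x [j [Mx lx]]] : exists x j,
    determined X x /\ (l *m twisted_trace T rep x j) 0 0 != 0.
  apply: contrapT => none; case/eqP: l0.
  apply: (twisted_trace_separates hX uT TP repP) => x j Mx.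
  by apply: contrapT => /eqP h; apply: none; exists x, j.
have [[g gx] _] := Mx; exists (r j - g), (twisted_trace T rep x j).
split=> // [|u]; first exact: twisted_trace_graded.
exact: (twisted_trace_invariant XP uT TP repP).
Qed.

End Cocycle.
End Extension.

(** * Descent *)

Theorem proposition1p18 (Gamma : porderZmodType) (k L : comUnitRingType)
    (iota : {rmorphism k -> L}) (kg : Gamma -> set k) (Lg : Gamma -> set L)
    (n : nat) (r : 'I_n -> Gamma) (alpha : galois_group iota Lg -> 'M[L]_n) :
  divisible_ordered_group Gamma ->
  graded_extension iota kg Lg ->
  is_galois iota Lg ->
  is_cocycle r alpha ->
  exists (s : 'I_n -> Gamma) (P : 'M[L]_n),
    graded_GL Lg r s P /\
    forall u : galois_group iota Lg, alpha u = map_mx u P *m invmx P.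
Proof.
move=> _ ext [alg _] aP; have LP := ext_top ext.
suff partial m : (m <= n)%N -> exists (s : 'I_n -> Gamma) (P : 'M[L]_n),
    graded_GL Lg r s P /\ forall j : 'I_n, (j < m)%N ->
      forall u, alpha u *m col j P = map_mx u (col j P).
  have [s [P [gP Pinv]]] := partial n (leqnn n); exists s, P; split=> // u.
  rewrite -[LHS](mulmxK (graded_GL_unit LP gP)); congr (_ *m _).
  apply/matrixP => i j; have /colP/(_ i) := Pinv j (ltn_ord j) u.
  by rewrite map_col {1}colE mulmxA -colE !mxE.
(* The first [m] columns are invariant; those not yet replaced are columns of
   the identity matrix, of degrees given by [r]. *)
elim: m => [|m IH] mn.
  exists r, 1%:M; split=> //; split=> [i j|]; last by rewrite det1 oner_neq0.
  rewrite mxE; case: eqP => [->|_] /=.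
    by rewrite subrr; apply: grading1 (graded_field_grading LP).
  exact: grading0 (graded_field_grading LP) _.
have [s [P [[gP dP] Pinv]]] := IH (ltnW mn).
pose j0 := Ordinal mn.
have [|t [v [gv vinv lv]]] := invariant_vector ext aP alg (l := row j0 (\adj P)).
  apply: contraNneq dP => l0.
  have -> : \det P = (row j0 (\adj P) *m col j0 P) 0 0.
    by rewrite colE mulmxA -row_mul -colE mul_adj_mx !mxE eqxx.
  by rewrite l0 mul0mx mxE.
exists (fun j => if j == j0 then t else s j), (set_col j0 v P); split.
  by split=> [i j|]; rewrite ?det_set_col // mxE; case: ifP.
move=> j jm u; have [->|jj0] := eqVneq j j0.
  rewrite (_ : col j0 _ = v) //.
  by apply/colP => i; rewrite !mxE eqxx.
rewrite (_ : col j _ = col j P); last by apply/colP => i; rewrite !mxE (negPf jj0).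
apply: Pinv; move: jm; rewrite ltnS leq_eqVlt => /predU1P[e|//].
by case/eqP: jj0; apply: val_inj.
Qed.
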